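(* Let $\lambda$ be a nonzero real number, $r\geq 0$ an integer and $z\in\mathbb{C}$. Then for every integer $n\geq0$, $$\langle z|(\hat{n}+r)_{n,\lambda}|z\rangle=\langle z|(a^\dagger a+r)_{n,\lambda}|z\rangle=\phi_{n,\lambda}^{(r)}(|z|^2).$$
   Context: Number states $|m\rangle$, $m=0,1,2,\dots$, form an orthonormal basis of a Hilbert space; $a|m\rangle=\sqrt{m}\,|m-1\rangle$ ($a|0\rangle=0$), $a^\dagger|m\rangle=\sqrt{m+1}\,|m+1\rangle$, and $\hat n=a^\dagger a$, so $\hat n|m\rangle=m|m\rangle$. The coherent state is $|z\rangle=e^{-|z|^2/2}\sum_{m=0}^\infty \frac{z^m}{\sqrt{m!}}|m\rangle$ (so $a|z\rangle=z|z\rangle$, $\langle z|z\rangle=1$), and $\langle z|A|z\rangle$ denotes the inner product of $|z\rangle$ with $A|z\rangle$. For an operator $X$, $(X)_{0,\lambda}=1$ and $(X)_{k,\lambda}=X(X-\lambda)\cdots(X-(k-1)\lambda)$; likewise $(x)_{k,\lambda}$ for numbers, and $(x)_k=x(x-1)\cdots(x-k+1)$, $(x)_0=1$. The degenerate $r$-Stirling numbers of the second kind are defined by $(x+r)_{n,\lambda}=\sum_{k=0}^n \begin{Bmatrix}n+r \\ k+r \end{Bmatrix}_{r,\lambda}(x)_k$, and the degenerate $r$-Bell polynomials by $\phi_{n,\lambda}^{(r)}(x)=\sum_{k=0}^n \begin{Bmatrix}n+r \\ k+r \end{Bmatrix}_{r,\lambda}x^k$, equivalently by $e_\lambda^r(t)e^{x(e_\lambda(t)-1)}=\sum_{n\ge0}\phi_{n,\lambda}^{(r)}(x)\frac{t^n}{n!}$,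 where $e_\lambda^x(t)=(1+\lambda t)^{x/\lambda}=\sum_{k\ge0}(x)_{k,\lambda}\frac{t^k}{k!}$ and $e_\lambda(t)=e_\lambda^1(t)$. *)

(* Defs.v *)
From HB Require Import structures.
From mathcomp Require Import all_boot all_order all_algebra.
From mathcomp Require Import sesquilinear complex.
From mathcomp Require Import all_classical all_reals all_analysis.
Set Implicit Arguments.
Unset Strict Implicit.
Unset Printing Implicit Defensive.
Import Order.TTheory GRing.Theory Num.Theory.
Import numFieldNormedType.Exports.
Local Open Scope classical_set_scope.
Local Open Scope complex_scope.
Local Open Scope ring_scope.

Section DegenerateNumbers.
Variable R : realType.
Implicit Types (lambda x : R) (r n k : nat).

Definition falling x k : R := \prod_(i < k) (x - i%:R).

Definition deg_falling lambda x k : R := \prod_(i < k) (x - i%:R * lambda).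

(* The coefficients of the expansion are unique because the falling
   factorials are linearly independent functions on R; [xget] names them.
   The indices n and k stand for the shifted entries n + r and k + r of the
   usual brace notation. *)
Definition deg_rstirling2 lambda r n : nat -> R :=
  xget (fun=> 0) [set S : nat -> R |
    (forall x, deg_falling lambda (x + r%:R) n =
               \sum_(k < n.+1) S k * falling x k) /\
    (forall k, (n < k)%N -> S k = 0)].

Definition deg_rbell lambda r n : {poly R} :=
  \poly_(k < n.+1) deg_rstirling2 lambda r n k.

End DegenerateNumbers.

(* Unbounded operators: [oapp A] is only meaningful on [dom A].  Sums and
   products carry their natural domains. *)
Record operator (T : Type) := Operator { dom : set T; oapp :> T -> T }.

Section OperatorAlgebra.
Variables (K : numFieldType) (H : lmodType K).
Implicit Types (A B : operator H) (c : K).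

Definition oscal c : operator H := Operator setT (fun v => c *: v).

Definition oadd A B : operator H :=
  Operator (dom A `&` dom B) (fun v => A v + B v).

Definition ocomp A B : operator H :=
  Operator (dom B `&` B @^-1` dom A) (fun v => A (B v)).

Fixpoint odeg_falling (lambda : K) A (k : nat) : operator H :=
  if k is k'.+1 then
    ocomp (odeg_falling lambda A k') (oadd A (oscal (- (k'%:R * lambda))))
  else oscal 1.

End OperatorAlgebra.

Section Fock.
Variables (R : realType) (H : completeNormedModType R[i]).
Variable dotp : {dot H for Num.conj}.
Implicit Types (e f : nat -> H) (u v : H) (z : R[i]).

(* Together with the completeness of H, this makes H a Hilbert space. *)
Definition norm_from_dot := forall v, `|v| ^+ 2 = dotp v v.

(* Library forms are linear on the left, brackets are linear on the right. *)
Definition braket u v : R[i] := dotp v u.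

Definition orthonormal_basis e :=
  (forall i j, braket (e i) (e j) = (i == j)%:R) /\
  (forall v, series (fun m => braket (e m) v *: e m) @ \oo --> v).

(* The operator sending the basis vector e m to f m, with domain all v such
   that the expansion \sum_m <e m|v> f m converges.  For the ladder operators
   below, this is the closed operator extending the action on number states,
   with its usual domain (those v for which \sum_m m |<e m|v>|^2 is finite). *)
Definition basis_operator e f : operator H :=
  let s v := series (fun m => braket (e m) v *: f m) in
  Operator [set v | cvgn (s v)] (fun v => limn (s v)).

Definition annihilation e : operator H :=
  basis_operator e (fun m =>
    if m is m'.+1 then (Num.sqrt (m'.+1%:R : R))%:C *: e m' else 0).

Definition creation e : operator H :=
  basis_operator e (fun m => (Num.sqrt (m.+1%:R : R))%:C *: e m.+1).

Definition number_operator e : operator H :=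
  ocomp (creation e) (annihilation e).

Definition coherent e z : H :=
  (expR (- (ComplexField.Normc.normc z ^+ 2) / 2))%:C *:
    limn (series (fun m => (z ^+ m / (Num.sqrt (m`!%:R : R))%:C) *: e m)).

End Fock.

(* Main.v *)
(** On a vector whose coefficients [c m] decay faster than every geometric
    sequence, the ladder operators act coefficientwise and again give such a
    vector; hence the operator falling factorial of [n + r] multiplies [c m] by
    [(m + r)_{n,lambda}].  The coherent state is of this kind, with
    [|c m|^2 = e^{-x} x^m / m!] for [x = |z|^2].  Expanding [(m + r)_{n,lambda}]
    in falling factorials and summing [(m)_k x^m / m!] to [x^k e^x] gives the
    Bell polynomial (a Dobinski formula). *)

Require Import Defs.
From HB Require Import structures.
From mathcomp Require Import all_boot all_order all_algebra.
From mathcomp Require Import sesquilinear complex.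
From mathcomp Require Import all_classical all_reals all_analysis.
From mathcomp Require Import ring.
Set Implicit Arguments.
Unset Strict Implicit.
Unset Printing Implicit Defensive.
Import Order.TTheory GRing.Theory Num.Theory.
Import numFieldNormedType.Exports.
Local Open Scope classical_set_scope.
Local Open Scope complex_scope.
Local Open Scope ring_scope.

(** * Degenerate falling factorials and the Dobinski sum over the reals *)

Lemma falling_rec {R : realType} (x : R) k :
  falling x k.+1 = falling x k * (x - k%:R).
Proof. by rewrite /falling big_ord_recr. Qed.

Lemma fallingSS {R : realType} (m k : nat) :
  falling (m.+1%:R : R) k.+1 = m.+1%:R * falling (m%:R : R) k.
Proof.
rewrite /falling big_ord_recl /= subr0; congr (_ * _).
by apply: eq_bigr => i _; rewrite /bump /= add1n -!natr1; ring.
Qed.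

(** Induction on [n]: the new factor [x + r - n * lambda] is [(x - k) + w k]; the first summand
    raises [falling x k] to [falling x k.+1], the second rescales it. This is the recurrence of the
    Stirling numbers. *)
Lemma deg_falling_expansion {R : realType} (lambda : R) r n :
  exists S : nat -> R,
    (forall x, deg_falling lambda (x + r%:R) n =
               \sum_(k < n.+1) S k * falling x k) /\
    (forall k, (n < k)%N -> S k = 0).
Proof.
elim: n => [|n [S [hS S0]]].
  exists (fun k => (k == 0%N)%:R); split=> [x|[]//].
  by rewrite big_ord1 /deg_falling /falling !big_ord0 mulr1.
pose w k : R := k%:R + r%:R - n%:R * lambda.
exists (fun k => (if k is k'.+1 then S k' else 0) + w k * S k); split.
  move=> x; rewrite /deg_falling big_ord_recr /= -/(deg_falling _ _ _) hS.
  under [RHS]eq_bigr do rewrite mulrDl; rewrite big_split /=.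
  rewrite [X in _ = X + _]big_ord_recl /= mul0r add0r.
  rewrite [X in _ = _ + X]big_ord_recr /= S0// mulr0 mul0r addr0 -big_split/=.
  rewrite mulr_suml; apply: eq_bigr => k _.
  by rewrite /bump /= add1n falling_rec /w; ring.
by case=> // k nk; rewrite !S0 ?mulr0 ?addr0// ltnW.
Qed.

(** Existence of an expansion excludes the default value of [xget]. *)
Lemma deg_falling_rstirling2 {R : realType} (lambda : R) r n x :
  deg_falling lambda (x + r%:R) n =
  \sum_(k < n.+1) deg_rstirling2 lambda r n k * falling x k.
Proof.
have [S hS] := deg_falling_expansion lambda r n.
by rewrite /deg_rstirling2; case: xgetP => [_ -> [->]//|/(_ S)].
Qed.

Lemma cvg_series_falling_exp {R : realType} (x : R) k :
  series (fun m => falling m%:R k * exp_coeff x m) @ \oo --> x ^+ k * expR x.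
Proof.
elim: k => [|k IH].
  under eq_fun do rewrite /falling big_ord0 mul1r; rewrite mul1r.
  exact: is_cvg_series_exp_coeff.
(* The term at [m = 0] vanishes for [k.+1]; after a shift of the index, each term is [x] times the
   corresponding term for [k]. *)
rewrite -cvg_shiftS exprS -mulrA.
under eq_fun => N.
  rewrite /series /= big_nat_recl//= /falling big_ord_recl /= subrr !mul0r add0r.
  under eq_bigr => i _.
    rewrite -/(falling _ _) fallingSS /exp_coeff /= exprS factS natrM invfM.
    rewrite (_ : _ * _ = x * (falling i%:R k * exp_coeff x i)); last first.
      rewrite /exp_coeff /=; field.
      by rewrite nat1r !pnatr_eq0 -lt0n fact_gt0.
    over.
  rewrite -mulr_sumr.
  over.
exact: cvgM (cvg_cst _) IH.
Qed.

Lemma cvg_series_deg_falling_exp {R : realType} (lambda x : R) r n :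
  series (fun m => deg_falling lambda (m%:R + r%:R) n * exp_coeff x m) @ \oo
    --> (deg_rbell lambda r n).[x] * expR x.
Proof.
rewrite /deg_rbell horner_poly mulr_suml.
rewrite (_ : series _ = fun N => \sum_(k < n.+1) deg_rstirling2 lambda r n k *
     series (fun m => falling m%:R k * exp_coeff x m) N); last first.
  apply/funext => N; rewrite /series /=.
  under [RHS]eq_bigr do rewrite mulr_sumr; rewrite exchange_big /=.
  apply: eq_bigr => m _; rewrite deg_falling_rstirling2 mulr_suml.
  by apply: eq_bigr => k _; rewrite mulrA.
apply: cvg_big => [|k _]; first exact: add_continuous.
rewrite -mulrA.
apply: cvgM; [exact: cvg_cst | exact: cvg_series_falling_exp].
Qed.

(** * Comparison test and continuity of the bracket *)

Section FockKets.
Variables (R : realType) (H : completeNormedModType R[i]).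
Variable dotp : {dot H for Num.conj}.
Hypothesis hnorm : norm_from_dot dotp.
Implicit Types (u : nat -> H) (v w : H) (c d : nat -> R[i]).

Lemma series_cvg_of_norm_le u (b : nat -> R) :
  (forall m, `|u m| <= (b m)%:C) -> cvgn (series b) -> cvgn (series u).
Proof.
move=> ub /cvg_cauchy/cauchy_seriesP bC.
apply/cauchy_cvgP/cauchy_seriesP => eps eps0.
(* A positive element of [R[i]] is real, so the Cauchy criterion for [b] applies to its real
   part. *)
have epsE : eps = (complex.Re eps)%:C by rewrite RRe_real// gtr0_real.
have /bC : 0 < complex.Re eps by rewrite -ltcR -epsE.
apply: filterS => -[p q] /= hb; rewrite epsE.
apply: le_lt_trans (ler_norm_sum _ _ _) _.
apply: (@le_lt_trans _ _ (\sum_(p <= k < q) b k)%:C).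
  by rewrite rmorph_sum /=; apply: ler_sum => k _.
by rewrite ltcR; apply: le_lt_trans hb; exact: ler_norm.
Qed.

Lemma braket_Cauchy_Schwarz v w : `|braket dotp v w| <= `|v| * `|w|.
Proof.
have [->|w0] := eqVneq w 0.
  by rewrite /braket linear0l normr0 mulr_ge0.
rewrite /braket -(@ler_pXn2r _ 2)// ?nnegrE ?mulr_ge0// exprMn !hnorm.
rewrite mulrC.
set d := dotp w v; set W := dotp w w; set V := dotp v v.
have W0 : 0 < W by rewrite /W neq0_dnorm_gt0.
(* This vector is [W] times the component of [v] orthogonal to [w]; its squared norm is
   [W * (W * V - |d|^2)], and [W > 0] can be cancelled. *)
have : 0 <= dotp (W *: v - d^* *: w) (W *: v - d^* *: w) by exact: dnorm_ge0.
rewrite dnormB !dnormZ -/W -/V linearZl_LR linearZr_LR /= conjCK.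
rewrite (_ : dotp v w = d^*); last by rewrite /d [dotp w v]hermC /= expr0 mul1r conjCK.
rewrite norm_conjC (ger0_norm (ltW W0)) -normCK conj_Creal; last first.
  by apply: realM; [exact: gtr0_real | exact/ger0_real/exprn_ge0].
rewrite (_ : _ - _ = W * (W * V - `|d| ^+ 2)); last by ring.
by rewrite pmulr_rge0// subr_ge0.
Qed.

Lemma cvg_braket v u w :
  u @ \oo --> w ->
  (braket dotp v (u n) : R[i]^o) @[n --> \oo] --> (braket dotp v w : R[i]^o).
Proof.
move=> uw; apply/cvgrPdist_le => eps eps0.
(* Adding 1 keeps the divisor positive when [v = 0]. *)
have v1 : 0 < `|v| + 1 by rewrite ltr_wpDl.
move/cvgrPdist_le : uw => /(_ (eps / (`|v| + 1))); rewrite divr_gt0// => /(_ isT).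
apply: filterS => n hn; rewrite /braket -linearBl.
apply: le_trans (braket_Cauchy_Schwarz _ _) _.
apply: (@le_trans _ _ ((`|v| + 1) * `|w - u n|)).
  by rewrite ler_wpM2r// lerDl.
by rewrite mulrC -ler_pdivlMr.
Qed.

Lemma braket_sum v u n :
  braket dotp v (\sum_(0 <= m < n) u m) = \sum_(0 <= m < n) braket dotp v (u m).
Proof.
by rewrite /braket; elim/big_rec2 : _ => [|m y x _ <-]; rewrite ?linear0l ?linearDl.
Qed.

Lemma braketZ v a w : braket dotp v (a *: w) = a * braket dotp v w.
Proof. by rewrite /braket linearZl_LR. Qed.

Lemma braketC v w : braket dotp v w = (braket dotp w v)^*.
Proof. by rewrite /braket [LHS]hermC /= expr0 mul1r. Qed.

(** * Kets with rapidly decaying coefficients and the operators acting on them *)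

Variable e : nat -> H.
Hypothesis he : orthonormal_basis dotp e.

(* Superpolynomial decay of coefficients, in a form stable under the index
   shifts and the factors of at most exponential growth produced by the ladder
   operators. *)
Definition superexp_decay c :=
  forall a : nat, exists M : R, forall m, `|c m| * a%:R ^+ m <= M%:C.

Definition ket c : H := limn (series (fun m => c m *: e m)).

Lemma superexp_decay_le c d (K : R) (b : nat) :
  (forall m, `|d m| <= K%:C * b%:R ^+ m * `|c m|) ->
  superexp_decay c -> superexp_decay d.
Proof.
(* The factor [b ^ m] is absorbed by testing the decay of [c] at base [b * a]. As [K] may be
   negative, [Num.max K 0] replaces it. *)
move=> dc hc a; have [M hM] := hc (b * a)%N.
exists (Num.max K 0 * M) => m.
have K0 : 0 <= (Num.max K 0)%:C by rewrite ler0c le_max lexx orbT.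
rewrite rmorphM /=; apply: le_trans (ler_wpM2l K0 (hM m)).
rewrite natrM exprMn.
apply: (@le_trans _ _ (K%:C * b%:R ^+ m * `|c m| * a%:R ^+ m)).
  by rewrite ler_wpM2r// exprn_ge0.
rewrite [leRHS](_ : _ = (Num.max K 0)%:C * (b%:R ^+ m * `|c m| * a%:R ^+ m));
  last by ring.
rewrite -!mulrA ler_wpM2r ?mulr_ge0// ?exprn_ge0//.
by rewrite lecR le_max lexx.
Qed.

Lemma superexp_decayS c : superexp_decay c -> superexp_decay (fun m => c m.+1).
Proof.
(* The base [a.+1] is at least 1 even for [a = 0], so the extra power created by the shift only
   enlarges the left side. *)
move=> hc a; have [M hM] := hc a.+1; exists M => m.
apply: le_trans (hM m.+1); rewrite ler_wpM2l//.
apply: (@le_trans _ _ (a.+1%:R ^+ m)).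
  by rewrite lerXn2r ?nnegrE// ler_nat.
by rewrite exprS ler_peMl ?exprn_ge0// ler1n.
Qed.

Lemma superexp_decayZ (a : R[i]) c :
  superexp_decay c -> superexp_decay (fun m => a * c m).
Proof.
apply: (@superexp_decay_le _ _ (complex.Re `|a|) 1) => m.
by rewrite normrM RRe_real ?normr_real// expr1n mulr1.
Qed.

Lemma norm_basis m : `|e m| = 1.
Proof.
have /eqP := hnorm (e m); have := he.1 m m; rewrite /braket => ->.
by rewrite eqxx -[X in _ == X](expr1n _ 2) eqrXn2// => /eqP.
Qed.

(** Decay at base 2 dominates the terms by a geometric series of ratio 1/2. *)
Lemma is_cvg_ket c : superexp_decay c -> cvgn (series (fun m => c m *: e m)).
Proof.
move=> /(_ 2%N)[M hM].
apply: (@series_cvg_of_norm_le _ (geometric M 2^-1)).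
  move=> m; rewrite normrZ norm_basis mulr1 /= rmorphM rmorphXn /= fmorphV rmorph_nat.
  by rewrite exprVn ler_pdivlMr// exprn_gt0.
apply: is_cvg_geometric_series.
by rewrite ger0_norm ?invf_lt1 ?ltr1n ?invr_ge0.
Qed.

Lemma braket_ket v c : superexp_decay c ->
  (series (fun m => c m * braket dotp v (e m)) n : R[i]^o) @[n --> \oo]
    --> (braket dotp v (ket c) : R[i]^o).
Proof.
move=> /is_cvg_ket /(@cvg_braket v).
rewrite (_ : (fun n => _) = series (fun m => c m * braket dotp v (e m)))//.
apply/funext => n; rewrite /series /= braket_sum.
by apply: eq_bigr => m _; rewrite braketZ.
Qed.

Lemma braket_basis_ket c m : superexp_decay c -> braket dotp (e m) (ket c) = c m.
Proof.
move=> /(@braket_ket (e m)) /cvg_unique; apply => //.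
(* By orthonormality the partial sums equal [c m] as soon as they include the index [m]. *)
apply: cvg_near_cst; exists m.+1 => // n /= mn.
rewrite /series /= big_mkord (bigD1 (Ordinal mn)) //= (he.1 _ _) eqxx mulr1.
rewrite big1 ?addr0// => k km; rewrite (he.1 _ _) [m == k]eq_sym.
by rewrite -val_eqE /= in km; rewrite (negPf km) mulr0.
Qed.

Lemma ketD c d : superexp_decay c -> superexp_decay d ->
  ket c + ket d = ket (fun m => c m + d m).
Proof.
move=> hc hd; apply/esym/cvg_lim => //.
rewrite (_ : series _ = series (fun m => c m *: e m) + series (fun m => d m *: e m)).
  by apply: cvgD; exact: is_cvg_ket.
apply/funext => n; rewrite /series /= fctE -big_split.
by apply: eq_bigr => m _; rewrite scalerDl.
Qed.

Lemma ketZ a c : superexp_decay c -> a *: ket c = ket (fun m => a * c m).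
Proof.
move=> hc; apply/esym/cvg_lim => //.
rewrite (_ : series _ = (fun n => a *: series (fun m => c m *: e m) n)).
  by apply: cvgZr; exact: is_cvg_ket.
apply/funext => n; rewrite /series /= scaler_sumr.
by apply: eq_bigr => m _; rewrite scalerA.
Qed.

Lemma annihilation_ket c : superexp_decay c ->
  let d m := (Num.sqrt (m.+1%:R : R))%:C * c m.+1 in
  [/\ superexp_decay d, dom (annihilation dotp e) (ket c) &
      annihilation dotp e (ket c) = ket d].
Proof.
move=> hc d.
have hd : superexp_decay d.
  apply: (@superexp_decay_le _ _ 1 2) (superexp_decayS hc) => m.
  rewrite /d normrM mul1r ler_wpM2r// ger0_norm ?ler0c ?sqrtr_ge0//.
  rewrite -(rmorph_nat (real_complex R)) -rmorphXn /= lecR.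
  (* The weight is absorbed by [sqrt (m + 1) <= m + 1 <= 2 ^ m]. *)
  apply: (@le_trans _ _ m.+1%:R); last by rewrite -natrX ler_nat ltn_expl.
  by rewrite -(@ler_pXn2r _ 2)// ?nnegrE ?sqrtr_ge0// sqr_sqrtr// ler_eXnr ?ler1n.
set f := (fun m => if m is m'.+1 then (Num.sqrt (m'.+1%:R : R))%:C *: e m' else 0).
have cv : series (fun m => braket dotp (e m) (ket c) *: f m) @ \oo --> ket d.
  rewrite -cvg_shiftS /=.
  rewrite (_ : (fun n => _) = series (fun m => d m *: e m)); first exact: is_cvg_ket.
  apply/funext => n; rewrite /series /= big_nat_recl//= scaler0 add0r.
  by apply: eq_bigr => m _; rewrite braket_basis_ket// scalerA mulrC.
split => //; first by apply/cvg_ex; exists (ket d).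
exact: cvg_lim.
Qed.

(** The image [d] is described by its values instead of a formula, so that [m * c m] can be supplied
    directly when the two ladder operators are composed. *)
Lemma creation_ket c d : superexp_decay c -> superexp_decay d -> d 0%N = 0 ->
  (forall m, d m.+1 = (Num.sqrt (m.+1%:R : R))%:C * c m) ->
  dom (creation dotp e) (ket c) /\ creation dotp e (ket c) = ket d.
Proof.
move=> hc hd d0 dS.
have cv : series (fun m => braket dotp (e m) (ket c) *:
    ((Num.sqrt (m.+1%:R : R))%:C *: e m.+1)) @ \oo --> ket d.
  rewrite (_ : series _ = (fun n => series (fun m => d m *: e m) n.+1)).
    by rewrite cvg_shiftS; exact: is_cvg_ket.
  apply/funext => n; rewrite /series /= big_nat_recl//= d0 scale0r add0r.
  by apply: eq_bigr => m _; rewrite braket_basis_ket// scalerA mulrC dS.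
split; first by apply/cvg_ex; exists (ket d).
exact: cvg_lim.
Qed.

(** The factor is bounded by [m + |a| <= (1 + |a|) * 2 ^ m]. *)
Lemma superexp_decay_affine (a : R[i]) c :
  superexp_decay c -> superexp_decay (fun m => (m%:R + a) * c m).
Proof.
apply: (@superexp_decay_le _ _ (1 + complex.Re `|a|) 2) => m.
have -> : (1 + complex.Re `|a|)%:C = 1 + `|a|.
  by rewrite -[in RHS](RRe_real (normr_real a)) rmorphD.
rewrite normrM ler_wpM2r//.
apply: le_trans (ler_normD _ _) _.
rewrite normr_nat mulrDl mul1r lerD//.
  by rewrite -natrX ler_nat ltnW// ltn_expl.
by rewrite ler_peMr// exprn_ege1// ler1n.
Qed.

Lemma number_operator_ket c : superexp_decay c ->
  dom (number_operator dotp e) (ket c) /\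
  number_operator dotp e (ket c) = ket (fun m => m%:R * c m).
Proof.
move=> hc; have [hd domc Ac] := annihilation_ket hc.
have hm : superexp_decay (fun m => m%:R * c m).
  have := superexp_decay_affine 0 hc.
  by under eq_fun do rewrite addr0.
have [|m|dome Cc] := creation_ket hd hm; first exact: mul0r.
  rewrite mulrA -rmorphM -expr2 sqr_sqrtr//= rmorph_nat//.
by rewrite -Cc; rewrite -Ac in dome *.
Qed.

(** Induction on [n] for all [c] at once: in [odeg_falling] the factor of highest index acts first,
    so the induction hypothesis is applied to the new ket [c1]. Decay of [c1] also settles the
    domain conditions. *)
Lemma odeg_falling_ket (lambda : R) r n c : superexp_decay c ->
  let A := odeg_falling lambda%:C
             (oadd (number_operator dotp e) (oscal H r%:R)) n in
  let d m := (deg_falling lambda (m%:R + r%:R) n)%:C * c m in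
  [/\ superexp_decay d, dom A (ket c) & A (ket c) = ket d].
Proof.
elim: n c => [|n IH] c hc /=.
  under eq_fun do rewrite /deg_falling big_ord0 mul1r.
  by split=> //; rewrite scale1r.
pose c1 m := (m%:R + (r%:R - n%:R * lambda%:C)) * c m.
have hc1 : superexp_decay c1 by exact: superexp_decay_affine.
have [domc Nc] := number_operator_ket hc.
have hm : superexp_decay (fun m => m%:R * c m).
  have := superexp_decay_affine 0 hc.
  by under eq_fun do rewrite addr0.
have hmr : superexp_decay (fun m => m%:R * c m + r%:R * c m).
  have := superexp_decay_affine r%:R hc.
  by under eq_fun do rewrite mulrDl.
have Bc : number_operator dotp e (ket c) + r%:R *: ket c +
          (- (n%:R * lambda%:C)) *: ket c = ket c1.
  rewrite Nc !ketZ// !ketD//; do ?exact: superexp_decayZ.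
  by congr ket; apply/funext => m; rewrite /c1; ring.
have [hd domA Ac] := IH _ hc1.
have dE : (fun m => (deg_falling lambda (m%:R + r%:R) n)%:C * c1 m) =
  (fun m => (deg_falling lambda (m%:R + r%:R) n.+1)%:C * c m).
  apply/funext => m; rewrite /deg_falling big_ord_recr /= /c1.
  rewrite rmorphM rmorphB rmorphD rmorphM !rmorph_nat /=; ring.
by rewrite -dE; split => //; rewrite Bc.
Qed.

End FockKets.

(** * Coherent states and the expectation value *)

Lemma exp_coeff_le_expR {R : realType} (x : R) m :
  0 <= x -> exp_coeff x m <= expR x.
Proof.
move=> x0; apply: (@le_trans _ _ (series (exp_coeff x) m.+1)).
  rewrite /series /= big_nat_recr //= lerDr sumr_ge0// => k _.
  exact: exp_coeff_ge0.
apply: nondecreasing_cvgn_le; last exact: is_cvg_series_exp_coeff.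
by apply: nondecreasing_series => k _ _; exact: exp_coeff_ge0.
Qed.

Lemma norm_coherent_coef {R : realType} (z : R[i]) m :
  `|z ^+ m / (Num.sqrt (m`!%:R : R))%:C| =
  (ComplexField.Normc.normc z ^+ m / Num.sqrt m`!%:R)%:C.
Proof.
rewrite normrM normfV normrX [`|_%:C|]ger0_norm ?ler0c ?sqrtr_ge0//.
by rewrite rmorphM fmorphV rmorphXn.
Qed.

Lemma superexp_decay_coherent {R : realType} (z : R[i]) :
  superexp_decay (fun m => z ^+ m / (Num.sqrt (m`!%:R : R))%:C).
Proof.
move=> a; set y := ComplexField.Normc.normc z * a%:R.
have y0 : 0 <= y by rewrite mulr_ge0// -ler0c; exact: (normr_ge0 z).
(* The square of [y ^ m / sqrt m!] is the [m]-th term of the exponential series at [y ^ 2], hence at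
   most [expR (y ^ 2)]. *)
exists (Num.sqrt (expR (y ^+ 2))) => m.
rewrite norm_coherent_coef -(rmorph_nat (real_complex R)) -rmorphXn -rmorphM /=.
rewrite mulrAC -exprMn -/y.
rewrite lecR -(@ler_pXn2r _ 2)// ?nnegrE ?divr_ge0 ?exprn_ge0 ?sqrtr_ge0//.
rewrite sqr_sqrtr ?expR_ge0// expr_div_n sqr_sqrtr// -exprM mulnC exprM.
by apply: exp_coeff_le_expR; rewrite exprn_ge0.
Qed.

Lemma cvg_real_complex {R : realType} (u : nat -> R) (l : R) :
  u @ \oo --> l -> ((u n)%:C : R[i]^o) @[n --> \oo] --> (l%:C : R[i]^o).
Proof.
move=> /cvgrPdist_le ul; apply/cvgrPdist_le => eps eps0.
have epsE : (complex.Re eps)%:C = eps by rewrite RRe_real// gtr0_real.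
have /ul : 0 < complex.Re eps by rewrite -ltcR epsE.
apply: filterS => n hn; rewrite -rmorphB /= normc_def /= expr0n addr0 sqrtr_sqr.
by rewrite -epsE lecR.
Qed.

Theorem theorem2 (R : realType) (H : completeNormedModType R[i])
    (dotp : {dot H for Num.conj}) (hnorm : norm_from_dot dotp)
    (e : nat -> H) (he : orthonormal_basis dotp e)
    (lambda : R) (hlambda : lambda != 0) (r : nat) (z : R[i]) (n : nat) :
  let ket_z := coherent e z in
  let N := odeg_falling lambda%:C
             (oadd (number_operator dotp e) (oscal H r%:R)) n in
  let AA := odeg_falling lambda%:C
              (oadd (ocomp (creation dotp e) (annihilation dotp e))
                    (oscal H r%:R)) n in
  [/\ dom N ket_z, dom AA ket_z,
      braket dotp ket_z (N ket_z) = braket dotp ket_z (AA ket_z) &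
      braket dotp ket_z (AA ket_z) =
        ((deg_rbell lambda r n).[ComplexField.Normc.normc z ^+ 2])%:C].
Proof.
move=> ket_z N AA.
set x := ComplexField.Normc.normc z ^+ 2.
pose c m := (expR (- x / 2))%:C * (z ^+ m / (Num.sqrt (m`!%:R : R))%:C).
have hc : superexp_decay c by exact/superexp_decayZ/superexp_decay_coherent.
have zE : ket_z = ket e c.
  rewrite /ket_z /coherent -/x -/(ket e _) (ketZ hnorm he)//.
  exact: superexp_decay_coherent.
have [hd domN NE] := odeg_falling_ket hnorm he lambda r n hc.
(* [AA] and [N] are convertible, because [number_operator] unfolds to the composition of the ladder
   operators. *)
rewrite -[AA]/N zE; split => //.
rewrite [N _]NE.
have := braket_ket hnorm he (v := ket e c) hd.
(* The bracket is the limit of the partial sums of [d m * (c m)^*], where [d m] is [c m] times the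
   degenerate falling factorial; it remains to show that they also tend to the Bell value. *)
move=> /cvg_unique; apply => //.
rewrite (_ : series _ = fun k => (series (fun m => deg_falling lambda (m%:R + r%:R) n
   * exp_coeff x m) k * expR (- x))%:C).
  (* The normalisation [expR (- x)] cancels the [expR x] of the Dobinski sum. *)
  rewrite [X in X%:C](_ : _ = (deg_rbell lambda r n).[x] * expR x * expR (- x)).
    apply: cvg_real_complex; apply: cvgM; last exact: cvg_cst.
    exact: cvg_series_deg_falling_exp.
  by rewrite -mulrA -expRD subrr expR0 mulr1.
apply/funext => k; rewrite /series /= mulr_suml rmorph_sum /=.
apply: eq_bigr => m _; rewrite braketC (braket_basis_ket hnorm he)//.
rewrite -[LHS]mulrA -[X in _ = X%:C]mulrA.
rewrite [X in _ * X = _](_ : _ = `|c m| ^+ 2); last exact: esym (normCK (c m)).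
rewrite rmorphM; congr (_ * _).
rewrite /c normrM norm_coherent_coef ger0_norm ?ler0c ?expR_ge0//.
rewrite -rmorphM -rmorphXn /=; congr _%:C.
rewrite exprMn expr_div_n sqr_sqrtr// -expRM_natr divfK ?pnatr_eq0//.
by rewrite /exp_coeff /= -!exprM [(2 * m)%N]mulnC mulrC.
Qed.
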